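(* Let $M\in\mathbb{C}^{k,p}$ and let $\mathcal{S}$ and $\mathbb{P}$ be as in the context (for fixed block sizes $p_i,k_i$). Then $$\mu_{\mathcal{S}}(M)=\sup_{P\in\mathbb{P}}\rho(PM).$$
   Context: Fix positive integers $k_1,\ldots,k_n$ and $p_1,\ldots,p_n$ with $\sum k_i=k$, $\sum p_i=p$. Let $\mathcal{S}:=\{\operatorname{diag}(\Delta_1,\ldots,\Delta_n):\Delta_i\in\mathbb{C}^{p_i,k_i}\}\subseteq\mathbb{C}^{p,k}$ (block-diagonal with rectangular diagonal blocks). For $M\in\mathbb{C}^{k,p}$, the structured $\mu$-value is $\mu_{\mathcal{S}}(M):=\big(\inf\{\|\Delta\|:\Delta\in\mathcal{S},\ \det(I_p-\Delta M)=0\}\big)^{-1}$ ($\|\cdot\|$ the spectral norm), with $\mu_{\mathcal S}(M)=0$ if no such $\Delta$ exists. A matrix $P\in\mathbb{C}^{m,l}$ is partially isometric if $\|Px\|=\|x\|$ for every $x$ orthogonal to the null space of $P$. $\mathbb{P}:=\{\operatorname{diag}(P_1,\ldots,P_n): P_i\in\mathbb{C}^{p_i,k_i}\text{ partially isometric}\}$. $\rho(\cdot)$ denotes the spectral radius. *)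

(* Defs.v *)
From HB Require Import structures.
From mathcomp Require Import all_boot all_order all_algebra.
From mathcomp Require Import boolp classical_sets reals complex.
Set Implicit Arguments. Unset Strict Implicit. Unset Printing Implicit Defensive.
Import Order.TTheory GRing.Theory Num.Theory.
Local Open Scope ring_scope.
Local Open Scope classical_set_scope.

Definition cabs (R : realType) (z : R[i]) : R := @Normc.normc R z.

Definition cinner (R : realType) (m : nat) (x y : 'cV[R[i]]_m) : R[i] :=
  \sum_(i < m) x i 0 * conjc (y i 0).

Definition vnorm (R : realType) (m : nat) (x : 'cV[R[i]]_m) : R :=
  Num.sqrt (\sum_(i < m) cabs (x i 0) ^+ 2).

Definition specnorm (R : realType) (m l : nat) (A : 'M[R[i]]_(m, l)) : R :=
  sup [set vnorm (A *m x) | x in [set x : 'cV[R[i]]_l | vnorm x <= 1]].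

(* spectral radius: supremum of the moduli of the eigenvalues (0 if none) *)
Definition specrad (R : realType) (m : nat) (A : 'M[R[i]]_m) : R :=
  sup [set cabs lam | lam in [set lam : R[i] | eigenvalue A lam]].

Definition partial_isometry (R : realType) (m l : nat) (P : 'M[R[i]]_(m, l)) : Prop :=
  forall x : 'cV[R[i]]_l,
    (forall y : 'cV[R[i]]_l, P *m y = 0 -> cinner x y = 0) ->
    vnorm (P *m x) = vnorm x.

Definition blockdiag (R : realType) (n : nat) (ps ks : 'I_n -> nat)
  (D : 'M[R[i]]_(\sum_(i < n) ps i, \sum_(i < n) ks i)) : Prop :=
  forall i j : 'I_n, i != j -> submxblock D i j = 0.

Definition inPP (R : realType) (n : nat) (ps ks : 'I_n -> nat)
  (P : 'M[R[i]]_(\sum_(i < n) ps i, \sum_(i < n) ks i)) : Prop :=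
  blockdiag P /\ forall i : 'I_n, partial_isometry (submxblock P i i).

Definition muS (R : realType) (n : nat) (ps ks : 'I_n -> nat)
  (M : 'M[R[i]]_(\sum_(i < n) ks i, \sum_(i < n) ps i)) : R :=
  if `[< exists D, blockdiag D /\ \det (1%:M - D *m M) = 0 >] then
    (inf [set specnorm D | D in
           [set D : 'M[R[i]]_(\sum_(i < n) ps i, \sum_(i < n) ks i) |
             blockdiag D /\ \det (1%:M - D *m M) = 0]])^-1
  else 0.

(* Main.v *)
(* A partial isometry is a contraction, so a nonzero eigenvalue [lam] of [P M]
   makes [P / lam] feasible with norm at most [1 / |lam|].

   Conversely let [D M x = x], with blocks [x_i = D_i (M x)_i], and let [u_i],
   [v_i] be unit vectors along [x_i] and [(M x)_i]. Then [D] may be replaced by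
   the blocks [z_i u_i v_i^*] with [z_i = |x_i| / |(M x)_i| <= |D|], and
   feasibility of such blocks reads [F z := det (1 - diag(z) N) = 0] where
   [N_ij = v_i^* M_ij u_j]. As [F] is affine in each [z_i], a zero of [F] of
   minimal max-norm [s] can be chosen with every [|z_i| = s] (Doyle's argument).
   The blocks [(z_i / s) u_i v_i^*] are then partial isometries, and [1 / s] is
   an eigenvalue of the resulting [P M]. *)
Require Import Defs.
From HB Require Import structures.
From mathcomp Require Import all_boot all_order all_algebra.
From mathcomp Require Import boolp classical_sets reals complex.
From mathcomp Require Import ring lra.
From mathcomp Require Import topology normedtype derive.
Import Order.TTheory GRing.Theory Num.Theory.
Local Open Scope ring_scope.
Local Open Scope classical_set_scope.
Import numFieldNormedType.Exports.
Set Implicit Arguments. Unset Strict Implicit. Unset Printing Implicit Defensive.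

(** * Suprema of nonnegative reals and the complex modulus *)

Lemma sup_nonneg (R : realType) (A : set R) :
  (forall x, A x -> 0 <= x) -> 0 <= sup A.
Proof.
(* An empty or unbounded set has [sup] equal to 0 by default. *)
move=> A0; have [[[x Ax] ubA]|/sup_out ->//] := pselect (has_sup A).
exact: le_trans (A0 _ Ax) (ub_le_sup ubA Ax).
Qed.

Lemma sup_le_nonneg (R : realType) (A : set R) (c : R) :
  0 <= c -> (forall x, A x -> x <= c) -> sup A <= c.
Proof.
move=> c0 Ac; have [->|/set0P A0] := eqVneq A set0; first by rewrite sup0.
exact: ge_sup.
Qed.

Lemma sqr_cabs (R : realType) (z : R[i]) :
  cabs z ^+ 2 = complex.Re z ^+ 2 + complex.Im z ^+ 2.
Proof. by case: z => a b; rewrite /cabs /= sqr_sqrtr ?addr_ge0 ?sqr_ge0. Qed.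

Lemma cabs_ge0 (R : realType) (z : R[i]) : 0 <= cabs z.
Proof. by case: z => a b; rewrite /cabs /= sqrtr_ge0. Qed.

Lemma cabs0 (R : realType) : cabs (0 : R[i]) = 0.
Proof. exact: Normc.normc0. Qed.

Lemma cabsM (R : realType) (z w : R[i]) : cabs (z * w) = cabs z * cabs w.
Proof. exact: Normc.normcM. Qed.

Lemma cabsV (R : realType) (z : R[i]) : cabs z^-1 = (cabs z)^-1.
Proof. exact: Normc.normcV. Qed.

Lemma cabsN (R : realType) (z : R[i]) : cabs (- z) = cabs z.
Proof. by case: z => a b; rewrite /cabs /= !sqrrN. Qed.

Lemma cabs_eq0 (R : realType) (z : R[i]) : (cabs z == 0) = (z == 0).
Proof. by apply/eqP/eqP => [/Normc.eq0_normc//|->]; exact: cabs0. Qed.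

Lemma cabs_real (R : realType) (a : R) : 0 <= a -> cabs (real_complex R a) = a.
Proof.
by move=> a0; rewrite /cabs /= expr0n addr0 sqrtr_sqr ger0_norm.
Qed.

Lemma cabsD (R : realType) (z w : R[i]) : cabs (z + w) <= cabs z + cabs w.
Proof. exact: le_normcD. Qed.

Lemma normr_Re_le (R : realType) (z : R[i]) : `|complex.Re z| <= cabs z.
Proof.
by rewrite -(@ler_pXn2r _ 2) ?nnegrE ?cabs_ge0// real_normK ?num_real//
  sqr_cabs lerDl sqr_ge0.
Qed.

Lemma normr_Im_le (R : realType) (z : R[i]) : `|complex.Im z| <= cabs z.
Proof.
by rewrite -(@ler_pXn2r _ 2) ?nnegrE ?cabs_ge0// real_normK ?num_real//
  sqr_cabs lerDr sqr_ge0.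
Qed.

Lemma mul_conjc (R : realType) (z : R[i]) :
  z * conjc z = real_complex R (cabs z ^+ 2).
Proof.
rewrite sqr_cabs; case: z => a b /=; apply/eqP.
by rewrite eq_complex /=; apply/andP; split; apply/eqP; ring.
Qed.

(** * Euclidean norm, spectral norm, adjoints and partial isometries *)

Section vnorm.
Variables (R : realType).
Implicit Types m l : nat.

Lemma vnorm_ge0 m (x : 'cV[R[i]]_m) : 0 <= vnorm x.
Proof. exact: sqrtr_ge0. Qed.

Lemma sqr_vnorm m (x : 'cV[R[i]]_m) :
  vnorm x ^+ 2 = \sum_(i < m) cabs (x i 0) ^+ 2.
Proof. by rewrite sqr_sqrtr// sumr_ge0// => i _; rewrite sqr_ge0. Qed.

Lemma cinner_self m (x : 'cV[R[i]]_m) :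
  cinner x x = real_complex R (vnorm x ^+ 2).
Proof.
by rewrite sqr_vnorm rmorph_sum; apply: eq_bigr => i _; rewrite mul_conjc.
Qed.

Lemma vnorm_eq0 m (x : 'cV[R[i]]_m) : (vnorm x == 0) = (x == 0).
Proof.
apply/idP/eqP => [x0|->]; last first.
  rewrite /vnorm big1 ?sqrtr0// => i _; by rewrite mxE cabs0 expr0n.
have := sqr_vnorm x; rewrite (eqP x0) expr0n => /esym/eqP.
rewrite psumr_eq0 => [/allP x0'|i _]; last exact: sqr_ge0.
apply/colP => i; rewrite mxE; apply/eqP; rewrite -cabs_eq0.
by have := x0' i (mem_index_enum i); rewrite sqrf_eq0.
Qed.

Lemma vnormZ m (a : R[i]) (x : 'cV[R[i]]_m) :
  vnorm (a *: x) = cabs a * vnorm x.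
Proof.
apply/eqP; rewrite -(@eqrXn2 _ 2)// ?mulr_ge0 ?cabs_ge0 ?vnorm_ge0//.
rewrite exprMn !sqr_vnorm mulr_sumr; apply/eqP; apply: eq_bigr => i _.
by rewrite mxE cabsM exprMn.
Qed.

Lemma cabs_le_vnorm m (x : 'cV[R[i]]_m) i : cabs (x i 0) <= vnorm x.
Proof.
rewrite -(@ler_pXn2r _ 2)// ?nnegrE ?cabs_ge0 ?vnorm_ge0// sqr_vnorm (bigD1 i)//=.
by rewrite lerDl sumr_ge0// => j _; rewrite sqr_ge0.
Qed.

Lemma cabs_sum (I : finType) (F : I -> R[i]) :
  cabs (\sum_i F i) <= \sum_i cabs (F i).
Proof.
elim/big_ind2 : _ => // [|x a y b xa yb]; first by rewrite cabs0.
by apply: le_trans (cabsD _ _) _; exact: lerD.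
Qed.

(** Each entry of A x is at most an absolute row sum times the norm of x. The bound makes the [sup]
    in [specnorm] a genuine upper bound instead of the default 0. *)
Lemma mulmx_bounded m l (A : 'M[R[i]]_(m, l)) :
  exists2 c : R, 0 < c & forall x, vnorm (A *m x) <= c * vnorm x.
Proof.
pose c i := \sum_j cabs (A i j).
have c0 i : 0 <= c i by apply: sumr_ge0 => j _; exact: cabs_ge0.
have c20 : 0 <= \sum_i c i ^+ 2 by apply: sumr_ge0 => i _; exact: sqr_ge0.
(* The added 1 keeps the constant positive even for A = 0, so that it can be inverted later. *)
exists (1 + Num.sqrt (\sum_i c i ^+ 2)) => [|x].
  by rewrite ltr_pwDl// sqrtr_ge0.
apply: (@le_trans _ _ (Num.sqrt (\sum_i c i ^+ 2) * vnorm x)); last first.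
  by rewrite ler_wpM2r ?vnorm_ge0// lerDr.
rewrite -(@ler_pXn2r _ 2)// ?nnegrE ?mulr_ge0 ?sqrtr_ge0 ?vnorm_ge0//.
rewrite exprMn (sqr_sqrtr c20) [leLHS]sqr_vnorm mulr_suml; apply: ler_sum => i _.
rewrite -exprMn ler_pXn2r// ?nnegrE ?mulr_ge0 ?cabs_ge0 ?vnorm_ge0//.
rewrite mxE (le_trans (cabs_sum _))// mulr_suml; apply: ler_sum => j _.
by rewrite cabsM ler_wpM2l ?cabs_ge0// cabs_le_vnorm.
Qed.

Lemma specnorm_ge0 m l (A : 'M[R[i]]_(m, l)) : 0 <= specnorm A.
Proof. by apply: sup_nonneg => _ [x _ <-]; exact: vnorm_ge0. Qed.

Lemma vnorm_mulmx_le m l (A : 'M[R[i]]_(m, l)) x :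
  vnorm (A *m x) <= specnorm A * vnorm x.
Proof.
have [->|x0] := eqVneq x 0.
  rewrite mulmx0 (_ : vnorm 0 = 0) ?mulr_ge0 ?specnorm_ge0 ?vnorm_ge0//.
  by apply/eqP; rewrite vnorm_eq0.
have nx0 : 0 < vnorm x by rewrite lt0r vnorm_eq0 x0 vnorm_ge0.
have nxV : cabs (real_complex R (vnorm x)^-1) = (vnorm x)^-1.
  by rewrite cabs_real// invr_ge0 ltW.
rewrite -ler_pdivrMr// mulrC -[X in X * _]nxV -vnormZ scalemxAr.
apply: ub_le_sup.
  have [c c0 cA] := mulmx_bounded A; exists c => _ [y y1 <-].
  by rewrite (le_trans (cA y))// ler_piMr// ltW.
by exists (real_complex R (vnorm x)^-1 *: x) => //=; rewrite vnormZ nxV mulVf//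
  gt_eqF.
Qed.

Lemma specnorm_le m l (A : 'M[R[i]]_(m, l)) c : 0 <= c ->
  (forall x, vnorm (A *m x) <= c * vnorm x) -> specnorm A <= c.
Proof.
move=> c0 cA; apply: sup_le_nonneg => // _ [x /= x1 <-].
by rewrite (le_trans (cA x))// ler_piMr.
Qed.

Lemma specnormZ_le m l (a : R[i]) (A : 'M[R[i]]_(m, l)) :
  specnorm (a *: A) <= cabs a * specnorm A.
Proof.
apply: specnorm_le => [|x]; first by rewrite mulr_ge0 ?cabs_ge0 ?specnorm_ge0.
by rewrite -scalemxAl vnormZ -mulrA ler_wpM2l ?cabs_ge0// vnorm_mulmx_le.
Qed.

Definition adjmx m l (A : 'M[R[i]]_(m, l)) : 'M[R[i]]_(l, m) :=
  (map_mx conjc A)^T.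

Lemma cinnerE m (x y : 'cV[R[i]]_m) : cinner x y = (adjmx y *m x) 0 0.
Proof. by rewrite !mxE; apply: eq_bigr => i _; rewrite !mxE mulrC. Qed.

Lemma adjmxM m l k (A : 'M[R[i]]_(m, l)) (B : 'M[R[i]]_(l, k)) :
  adjmx (A *m B) = adjmx B *m adjmx A.
Proof. by rewrite /adjmx map_mxM trmx_mul. Qed.

Lemma adjmxK m l (A : 'M[R[i]]_(m, l)) : adjmx (adjmx A) = A.
Proof. by apply/matrixP => i j; rewrite !mxE conjcK. Qed.

(** The diagonal entries of A^* A are the squared norms of the columns of A. *)
Lemma adjmx_mul_eq0 m l (A : 'M[R[i]]_(m, l)) : adjmx A *m A = 0 -> A = 0.
Proof.
move=> A0; apply/matrixP => i j; rewrite mxE.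
have : col j A = 0.
  apply/eqP; rewrite -vnorm_eq0 -sqrf_eq0; apply/eqP.
  apply: (@complexI R); rewrite -cinner_self cinnerE.
  have -> : adjmx (col j A) = row j (adjmx A).
    by apply/matrixP => a b; rewrite !mxE.
  by rewrite colE mulmxA -row_mul A0 row0 mul0mx mxE.
by move=> /colP/(_ i); rewrite !mxE.
Qed.

(* The row space of [A] is that of [adjmx A *m A], so [P *m x] can be lifted to
   the range of [adjmx P], which is orthogonal to the kernel of [P]. *)
Lemma kernel_decomposition m l (P : 'M[R[i]]_(m, l)) (x : 'cV[R[i]]_l) :
  exists w : 'cV[R[i]]_m, P *m (adjmx P *m w) = P *m x.
Proof.
have : (P^T <= adjmx P^T *m P^T)%MS.
  (* With C the cokernel matrix of [adjmx P^T *m P^T], the product (P^T C)^* (P^T C) vanishes, hence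
     so does P^T C. *)
  rewrite submxE; apply/eqP; apply: adjmx_mul_eq0.
  by rewrite adjmxM -mulmxA [X in _ *m X]mulmxA mulmx_coker mulmx0.
move=> /submxP[D PD]; exists (x^T *m D)^T; apply: trmx_inj.
rewrite !trmx_mul trmxK [in RHS]PD !mulmxA; congr (_ *m _ *m _).
  by rewrite trmxK.
by apply/matrixP => i j; rewrite !mxE.
Qed.

(** Split x into a part in the range of P^*, on which P preserves the norm, and a part in the kernel
    of P; the two are orthogonal, so Pythagoras applies. *)
Lemma partial_isometry_le m l (P : 'M[R[i]]_(m, l)) x :
  partial_isometry P -> vnorm (P *m x) <= vnorm x.
Proof.
move=> Piso; have [w wP] := kernel_decomposition P x.
set x1 := adjmx P *m w in wP.
have orth y : P *m y = 0 -> cinner x1 y = 0.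
  by move=> Py; rewrite cinnerE mulmxA -adjmxM Py !mxE big1// => i _;
     rewrite !mxE conjc0 mul0r.
have orth' y : P *m y = 0 -> cinner y x1 = 0.
  by move=> Py; rewrite cinnerE adjmxM adjmxK -mulmxA Py mulmx0 mxE.
rewrite -wP Piso//.
rewrite -(@ler_pXn2r _ 2)// ?nnegrE ?vnorm_ge0// -lecR -!cinner_self.
have Px2 : P *m (x - x1) = 0 by rewrite mulmxBr wP subrr.
have -> : cinner x x = cinner x1 x1 + cinner (x - x1) (x - x1).
  rewrite -{1 2}(subrK x1 x).
  have e1 := orth _ Px2; have e2 := orth' _ Px2.
  move: e1 e2; rewrite !cinnerE; move: (x - x1) => t.
  have -> : adjmx (t + x1) = adjmx t + adjmx x1.
    by apply/matrixP => a b; rewrite !mxE rmorphD.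
  rewrite mulmxDl !mulmxDr => e1 e2.
  by rewrite !mxE in e1 e2 *; rewrite e1 e2 addr0 add0r addrC.
by rewrite lerDl cinner_self lecR sqr_ge0.
Qed.

(** The vector x - <x,v> v lies in the kernel of u v^*. If x is orthogonal to it, then |x|^2 =
    |<x,v>|^2, which is the squared norm of the image. *)
Lemma partial_isometry_rank1 m l (u : 'cV[R[i]]_m) (v : 'cV[R[i]]_l) :
  vnorm u = 1 -> vnorm v = 1 -> partial_isometry (u *m adjmx v).
Proof.
move=> u1 v1 x xorth.
have vxE : adjmx v *m x = (cinner x v)%:M.
  by rewrite cinnerE -mx11_scalar.
have vvE : adjmx v *m v = 1%:M.
  by rewrite [LHS]mx11_scalar -cinnerE cinner_self v1 expr1n.
rewrite -mulmxA vxE mul_mx_scalar vnormZ u1 mulr1.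
apply/eqP; rewrite -(@eqrXn2 _ 2)// ?cabs_ge0 ?vnorm_ge0//.
apply/eqP/(@complexI R).
have /xorth : u *m adjmx v *m (x - cinner x v *: v) = 0.
  by rewrite -mulmxA mulmxBr -scalemxAr vvE vxE scalemx1 subrr mulmx0.
rewrite cinnerE.
have -> : adjmx (x - cinner x v *: v) = adjmx x - conjc (cinner x v) *: adjmx v.
  by apply/matrixP => a b; rewrite !mxE rmorphB rmorphM.
rewrite mulmxBl -scalemxAl vxE -scalemx1 scalerA mxE -cinnerE cinner_self.
rewrite !mxE mulr1 => /eqP; rewrite subr_eq0 => /eqP ->.
by rewrite -mul_conjc mulrC.
Qed.

End vnorm.

(** * Continuity of complex-valued maps, through real and imaginary parts *)

Definition ccontinuous {R : realType} {T : topologicalType} (f : T -> R[i]) :=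
  continuous (fun t => complex.Re (f t)) /\ continuous (fun t => complex.Im (f t)).

Section ccontinuous.
Variables (R : realType) (T : topologicalType).
Implicit Types f g : T -> R[i].

Lemma ccontinuous_cst (c : R[i]) : ccontinuous (fun _ : T => c).
Proof. by split=> t; exact: cvg_cst. Qed.

Lemma ccontinuousD f g : ccontinuous f -> ccontinuous g ->
  ccontinuous (fun t => f t + g t).
Proof.
move=> [fR fI] [gR gI]; split.
- rewrite (_ : (fun t => _) = (fun t => complex.Re (f t) + complex.Re (g t))).
    by move=> t; apply: cvgD; [exact: fR|exact: gR].
  by apply/funext => t; case: (f t) (g t) => [a b] [c d].
- rewrite (_ : (fun t => _) = (fun t => complex.Im (f t) + complex.Im (g t))).
    by move=> t; apply: cvgD; [exact: fI|exact: gI].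
  by apply/funext => t; case: (f t) (g t) => [a b] [c d].
Qed.

Lemma ccontinuousM f g : ccontinuous f -> ccontinuous g ->
  ccontinuous (fun t => f t * g t).
Proof.
move=> [fR fI] [gR gI]; split.
- rewrite (_ : (fun t => _) = (fun t => complex.Re (f t) * complex.Re (g t)
                                      - complex.Im (f t) * complex.Im (g t))).
    by move=> t; apply: cvgB; apply: cvgM; [exact: fR|exact: gR|exact: fI|exact: gI].
  by apply/funext => t; case: (f t) (g t) => [a b] [c d].
- rewrite (_ : (fun t => _) = (fun t => complex.Re (f t) * complex.Im (g t)
                                      + complex.Im (f t) * complex.Re (g t))).
    by move=> t; apply: cvgD; apply: cvgM; [exact: fR|exact: gI|exact: fI|exact: gR].
  by apply/funext => t; case: (f t) (g t) => [a b] [c d].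
Qed.

Lemma ccontinuousN f : ccontinuous f -> ccontinuous (fun t => - f t).
Proof.
move=> /(ccontinuousM (ccontinuous_cst (-1))).
by congr ccontinuous; apply/funext => t; rewrite mulN1r.
Qed.

Lemma ccontinuous_sum (I : Type) (r : seq I) (F : I -> T -> R[i]) :
  (forall i, ccontinuous (F i)) -> ccontinuous (fun t => \sum_(i <- r) F i t).
Proof.
move=> cF; elim: r => [|i r IH].
  by under eq_fun do rewrite big_nil; exact: ccontinuous_cst.
by under eq_fun do rewrite big_cons; exact: ccontinuousD.
Qed.

Lemma ccontinuous_prod (I : Type) (r : seq I) (F : I -> T -> R[i]) :
  (forall i, ccontinuous (F i)) -> ccontinuous (fun t => \prod_(i <- r) F i t).
Proof.
move=> cF; elim: r => [|i r IH].
  by under eq_fun do rewrite big_nil; exact: ccontinuous_cst.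
by under eq_fun do rewrite big_cons; exact: ccontinuousM.
Qed.

Lemma ccontinuous_det n (A : T -> 'M[R[i]]_n) :
  (forall i j, ccontinuous (fun t => A t i j)) -> ccontinuous (fun t => \det (A t)).
Proof.
move=> cA; apply: ccontinuous_sum => s; apply: ccontinuousM.
  exact: ccontinuous_cst.
by apply: ccontinuous_prod => i; exact: cA.
Qed.

Lemma continuous_sqr_cabs f : ccontinuous f -> continuous (fun t => cabs (f t) ^+ 2).
Proof.
move=> [fR fI]; under eq_fun do rewrite sqr_cabs.
by move=> t; apply: cvgD; apply: cvgM; [exact: fR|exact: fR|exact: fI|exact: fI].
Qed.

End ccontinuous.

(** * Zeros of least max-norm of a function affine in each coordinate *)

Section torus.
Variables (R : realType) (n : nat).
Implicit Types (z : 'I_n -> R[i]) (w : R[i]) (i j : 'I_n).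

Definition update z i w : 'I_n -> R[i] := fun j => if j == i then w else z j.

Lemma update_id z i : update z i (z i) = z.
Proof. by apply/funext => j; rewrite /update; case: eqP => [->|]. Qed.

Variable F : ('I_n -> R[i]) -> R[i].
Hypothesis F_affine : forall z i w,
  F (update z i w) = F (update z i 0) + w * (F (update z i 1) - F (update z i 0)).
Hypothesis F_continuous : forall (T : topologicalType) (z : T -> 'I_n -> R[i]),
  (forall i, ccontinuous (fun t => z t i)) -> ccontinuous (fun t => F (z t)).
Hypothesis F0 : F (fun=> 0) != 0.

(** Compactness: the zeros in the closed polydisc of radius [r] form a nonempty compact set, on
    which a least max-norm is attained. *)
Lemma exists_zero_minimal_radius z0 r :
  0 <= r -> F z0 = 0 -> (forall i, cabs (z0 i) <= r) ->
  exists s, [/\ s <= r,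
    exists2 z, F z = 0 & forall i, cabs (z i) <= s &
    forall s' z, F z = 0 -> (forall i, cabs (z i) <= s') -> 0 <= s' -> s <= s'].
Proof.
move=> r0 Fz0 z0r.
(* A triple holds real parts, imaginary parts and a bound on all moduli. Minimising this last
   coordinate minimises the max-norm, with a mere projection as objective. *)
pose T := ('rV[R]_n * 'rV[R]_n * R)%type.
pose zof (t : T) i : R[i] := Complex (t.1.1 0 i) (t.1.2 0 i).
have czof i : ccontinuous (fun t => zof t i).
  split => /= t.
    apply: (@continuous_comp _ _ _ (fun t : T => t.1.1) (fun v : 'rV[R]_n => v 0 i)).
      by apply: (@continuous_comp _ _ _ (fun t : T => t.1) fst); [exact: cvg_fst|
        exact: cvg_fst].
    exact: coord_continuous.
  apply: (@continuous_comp _ _ _ (fun t : T => t.1.2) (fun v : 'rV[R]_n => v 0 i)).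
    by apply: (@continuous_comp _ _ _ (fun t : T => t.1) snd); [exact: cvg_fst|
      exact: cvg_snd].
  exact: coord_continuous.
have csnd : continuous (fun t : T => t.2) by move=> t; exact: cvg_snd.
pose K := [set t : T | [/\ F (zof t) = 0, forall i, cabs (zof t i) <= t.2 &
  0 <= t.2 <= r]].
have sqle (t : T) i : 0 <= t.2 ->
    (cabs (zof t i) ^+ 2 - t.2 ^+ 2 <= 0) = (cabs (zof t i) <= t.2).
  by move=> t0; rewrite subr_le0 ler_pXn2r// nnegrE cabs_ge0.
have Kcompact : compact K.
  pose I := `[- r, r]%classic.
  pose B := [set v : 'rV[R]_n | forall i, I (v 0 i)].
  have BK : compact ((B `*` B) `*` `[0, r]%classic : set T).
    apply: compact_setX; last exact: segment_compact.
    by apply: compact_setX; apply: (@rV_compact _ _ (fun=> I)) => i;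
      exact: segment_compact.
  apply: (subclosed_compact _ BK).
    (* With the moduli squared, each constraint is the preimage of a closed half-line under a
       continuous real map. *)
    have -> : K = [set t | cabs (F (zof t)) ^+ 2 <= 0] `&`
        (\bigcap_i [set t | cabs (zof t i) ^+ 2 - t.2 ^+ 2 <= 0]) `&`
        [set t | 0 <= t.2] `&` [set t | t.2 <= r].
      apply/seteqP; split => t.
        move=> [Ft tz /andP[t0 tr]]; split=> //; split=> //; split => /=.
          by rewrite Ft cabs0 expr0n.
        by move=> i _; exact: etrans (sqle _ _ t0) (tz i).
      move=> [[[/= Ft tz] t0] tr]; split=> [|i|]; last by rewrite t0 tr.
        by apply/eqP; rewrite -cabs_eq0 -sqrf_eq0 eq_le Ft sqr_ge0.
      exact: etrans (esym (sqle _ _ t0)) (tz i Logic.I).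
    apply: closedI; [apply: closedI; [apply: closedI|]|].
    - apply: (@preimage_closed _ _ (fun t => cabs (F (zof t)) ^+ 2) [set x | x <= 0]).
        by move=> t _; exact: (continuous_sqr_cabs (F_continuous czof)).
      exact: closed_le.
    - apply: closed_bigI => i _.
      apply: (@preimage_closed _ _ (fun t : T => cabs (zof t i) ^+ 2 - t.2 ^+ 2)
        [set x | x <= 0]); last exact: closed_le.
      move=> t _; apply: cvgB; first exact: (continuous_sqr_cabs (czof i)).
      by apply: cvgM; exact: csnd.
    - by apply: (@preimage_closed _ _ (fun t : T => t.2) [set x | 0 <= x]);
        [move=> ? _; exact: csnd|exact: closed_ge].
    - by apply: (@preimage_closed _ _ (fun t : T => t.2) [set x | x <= r]);
        [move=> ? _; exact: csnd|exact: closed_le].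
  move=> t [_ tz /andP[t0 tr]]; split; last by rewrite /= in_itv /= t0 tr.
  split=> i; rewrite /I /= in_itv /= -ler_norml (le_trans _ (le_trans (tz i) tr))//.
    exact: (normr_Re_le (zof t i)).
  exact: (normr_Im_le (zof t i)).
pose t0 : T := (\row_i complex.Re (z0 i), \row_i complex.Im (z0 i), r).
have zt0 : zof t0 = z0.
  by apply/funext => i; rewrite /zof /= !mxE; case: (z0 i).
have Kt0 : K t0 by split; rewrite ?zt0//= r0 lexx.
have [|c Kc cmin] := compact_EVT_min (ex_intro K t0 Kt0) Kcompact
  (f := fun t : T => t.2).
  exact: continuous_subspaceT.
rewrite inE in Kc; have [Fc cz /andP[c0 cr]] := Kc.
exists c.2; split=> //; first by exists (zof c).
(* A radius above [r] lies outside [K], but it already exceeds the minimum. *)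
move=> s' z Fz zs s'0; have [s'r|rs'] := leP s' r; last exact: ltW (le_lt_trans cr rs').
pose t : T := (\row_i complex.Re (z i), \row_i complex.Im (z i), s').
have zt : zof t = z.
  by apply/funext => i; rewrite /zof /= !mxE; case: (z i).
by apply: (cmin t); rewrite inE; split; rewrite ?zt//= s'0 s'r.
Qed.

(** Otherwise z would be the origin, where [F] does not vanish. *)
Lemma minimal_radius_gt0 s z : F z = 0 -> (forall i, cabs (z i) <= s) ->
  (forall s' z', F z' = 0 -> (forall i, cabs (z' i) <= s') -> 0 <= s' -> s <= s') ->
  0 < s.
Proof.
move=> Fz zs smin; rewrite ltNge; apply/negP => s0.
move: F0; rewrite (_ : (fun=> 0) = z) ?Fz ?eqxx//.
apply/funext => i; apply/esym/eqP; rewrite -cabs_eq0 eq_le cabs_ge0 andbT.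
exact: le_trans (zs i) s0.
Qed.

(* If [F] really depends on a coordinate of modulus [< s], shrink the other
   coordinates a little and solve the affine equation for that one. *)
Lemma minimal_zero_coord s z i : 0 < s -> F z = 0 -> (forall j, cabs (z j) <= s) ->
  (forall s' z', F z' = 0 -> (forall j, cabs (z' j) <= s') -> 0 <= s' -> s <= s') ->
  cabs (z i) < s -> forall w, F (update z i w) = 0.
Proof.
move=> s0 Fz zs smin zis.
(* On the shrunk point [zt t], [F] is the affine function a t + w * b t of its coordinate w at
   [i]. *)
pose zt (t : R) j := real_complex R (1 - t) * z j.
pose a t := F (update (zt t) i 0).
pose b t := F (update (zt t) i 1) - F (update (zt t) i 0).
have zt0 : zt 0 = z by apply/funext => j; rewrite /zt subr0 mul1r.
have ab0 : a 0 + z i * b 0 = 0 by rewrite /a /b zt0 -F_affine update_id.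
(* If the slope vanishes at t = 0, so does the constant term, and coordinate [i] is free. *)
have [b0|b0] := eqVneq (b 0) 0.
  move: ab0; rewrite b0 mulr0 addr0 => a0 w.
  by move: a0 b0; rewrite /a /b zt0 => a0 b0; rewrite F_affine b0 a0 mulr0 addr0.
have ca w : ccontinuous (fun t => F (update (zt t) i w)).
  apply: F_continuous => j; rewrite /update; case: eqP => _.
    exact: ccontinuous_cst.
  apply: ccontinuousM; last exact: ccontinuous_cst.
  split => /= t; last exact: cvg_cst.
  by apply: cvgB; [exact: cvg_cst|exact: cvg_id].
have cb : ccontinuous b by apply: ccontinuousD; [|apply: ccontinuousN].
(* [0 < h t] says that the root - a t / b t has modulus below [s], without dividing. It holds at t =
   0, where the root is [z i], and persists for small t by continuity. *)
pose h t := s ^+ 2 * cabs (b t) ^+ 2 - cabs (a t) ^+ 2.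
have ch : continuous h.
  move=> t; apply: cvgB; last exact: (continuous_sqr_cabs (ca 0)).
  by apply: cvgM; [exact: cvg_cst|exact: (continuous_sqr_cabs cb)].
have bgt0 : 0 < cabs (b 0) by rewrite lt0r cabs_eq0 b0 cabs_ge0.
have h0 : 0 < h 0.
  rewrite /h; have -> : a 0 = - (z i * b 0) by apply/eqP; rewrite -addr_eq0 ab0.
  rewrite cabsN cabsM -!exprMn subr_gt0 ltr_pXn2r ?nnegrE//.
  - by rewrite ltr_pM2r.
  - by rewrite mulr_ge0 ?cabs_ge0.
  - by rewrite mulr_ge0 ?cabs_ge0 ?ltW.
have [t [t0 t1 ht]] : exists t : R, [/\ 0 < t, t < 1 & 0 < h t].
  have : \forall t \near (0 : R), 0 < h t.
    by have /(cvgr_gt (h 0))/(_ 0 h0) := ch 0.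
  move=> /nbhs_ballP[e /= e0 he]; exists (Num.min (e / 2) 2^-1).
  split; [by rewrite lt_min; lra| by rewrite gt_min; apply/orP; right; lra|].
  apply: he; rewrite /ball /= sub0r normrN ger0_norm; last by rewrite le_min; lra.
  by rewrite gt_min; apply/orP; left; lra.
have bt0 : b t != 0.
  apply/eqP => bt0; move: ht; rewrite /h bt0 cabs0 expr0n mulr0 sub0r.
  by rewrite oppr_gt0 ltNge sqr_ge0.
have btgt0 : 0 < cabs (b t) by rewrite lt0r cabs_eq0 bt0 cabs_ge0.
pose w := - a t / b t.
have ws : cabs w < s.
  rewrite /w cabsM cabsV cabsN ltr_pdivrMr//.
  move: ht; rewrite /h subr_gt0 -exprMn ltr_pXn2r ?nnegrE ?cabs_ge0//.
  by rewrite mulr_ge0 ?cabs_ge0 ?ltW.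
(* Both terms are below [s], yet [s'] bounds all coordinates of a zero, against minimality. *)
pose s' := Num.max (cabs w) ((1 - t) * s).
suff : s <= s'.
  by rewrite leNgt gt_max ws /= gtr_pMl//; move/negP; case; lra.
apply: (smin s' (update (zt t) i w)).
- by rewrite F_affine -/(a t) -/(b t) /w mulfVK// subrr.
- move=> j; rewrite le_max /update; case: eqP => [_|_]; first by rewrite lexx.
  apply/orP; right; rewrite cabsM cabs_real; last by lra.
  by rewrite ler_pM2l; [exact: zs|lra].
- by rewrite le_max cabs_ge0.
Qed.

(** Starting from a zero of minimal radius [s], treat the coordinates in turn: one of modulus below
    [s] is free by [minimal_zero_coord], so it may be reset to [s] itself. *)
Lemma torus_zero z0 r : 0 <= r -> F z0 = 0 -> (forall i, cabs (z0 i) <= r) ->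
  exists s z, [/\ 0 < s, s <= r, F z = 0 & forall i, cabs (z i) = s].
Proof.
move=> r0 Fz0 z0r.
have [s [sr [z1 Fz1 z1s] smin]] := exists_zero_minimal_radius r0 Fz0 z0r.
have s0 := minimal_radius_gt0 Fz1 z1s smin.
suff /(_ n)[z [Fz zs zeq]] : forall k, exists z,
    [/\ F z = 0, forall i, cabs (z i) <= s &
      forall i : 'I_n, (i < k)%N -> cabs (z i) = s].
  by exists s, z; split=> // i; exact: zeq.
elim=> [|k [z [Fz zs zeq]]]; first by exists z1.
have [kn|nk] := ltnP k n; last first.
  exists z; split=> // i _; exact: zeq (leq_trans (ltn_ord i) nk).
pose i := Ordinal kn.
have [zis|zis] := ltP (cabs (z i)) s; last first.
  exists z; split=> // j; rewrite ltnS leq_eqVlt => /predU1P[jk|]; last exact: zeq.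
  rewrite (_ : j = i); last exact: val_inj.
  by apply/eqP; rewrite eq_le zis zs.
exists (update z i (real_complex R s)).
have cs : cabs (real_complex R s) = s by rewrite cabs_real// ltW.
split.
- exact: minimal_zero_coord s0 Fz zs smin zis _.
- by move=> j; rewrite /update; case: eqP => _; rewrite ?cs.
- move=> j; rewrite ltnS leq_eqVlt /update => /predU1P[jk|jk].
    by rewrite ifT// -val_eqE; apply/eqP.
  by case: eqP => // _; exact: zeq.
Qed.

End torus.

(** * Eigenvectors and fixed vectors as columns *)

Lemma eigenvalue_colP (F : fieldType) n (A : 'M[F]_n) a :
  reflect (exists2 x : 'cV_n, x != 0 & A *m x = a *: x) (eigenvalue A a).
Proof.
(* [eigenvalue] refers to row vectors; a matrix and its transpose share their characteristic
   polynomial. *)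
have -> : eigenvalue A a = eigenvalue A^T a.
  by rewrite !eigenvalue_root_char /char_poly /char_poly_mx -[in RHS]det_tr
     linearB /= tr_scalar_mx map_trmx trmxK.
apply: (iffP eigenvalueP) => [[v vA v0]|[x x0 Ax]].
  exists v^T; first by rewrite trmx_eq0.
  by apply: trmx_inj; rewrite trmx_mul trmxK linearZ /= trmxK.
exists x^T; last by rewrite trmx_eq0.
by rewrite -trmx_mul Ax linearZ.
Qed.

Lemma det1B_eq0P (F : fieldType) n (A : 'M[F]_n) :
  reflect (exists2 x : 'cV_n, x != 0 & A *m x = x) (\det (1%:M - A) == 0).
Proof.
rewrite -det_tr; apply: (iffP det0P) => [[v v0 vA]|[x x0 Ax]].
  exists v^T; first by rewrite trmx_eq0.
  apply: trmx_inj; rewrite trmx_mul trmxK; apply/eqP.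
  by rewrite eq_sym -subr_eq0 -{1}[v]mulmx1 -mulmxBr -[1%:M]tr_scalar_mx -linearB
    /= vA.
exists x^T; first by rewrite trmx_eq0.
by rewrite -trmx_mul mulmxBl mul1mx Ax subrr trmx0.
Qed.

(** * The function det (1 - diag(z) N) *)

Section scaled_rows.
Variables (R : realType) (n : nat) (N : 'M[R[i]]_n).

Definition det_scaled_rows (z : 'I_n -> R[i]) : R[i] :=
  \det (1%:M - \matrix_(i, j) (z i * N i j)).

Lemma det_scaled_rows0 : det_scaled_rows (fun=> 0) != 0.
Proof.
rewrite /det_scaled_rows (_ : \matrix_(i, j) _ = 0) ?subr0 ?det1 ?oner_eq0//.
by apply/matrixP => i j; rewrite !mxE mul0r.
Qed.

(** The coordinate z_i enters row i only, and there the row at w is (1 - w) times the row at 0 plus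
    w times the row at 1; the determinant is linear in that row. *)
Lemma det_scaled_rows_affine z i w :
  det_scaled_rows (update z i w) = det_scaled_rows (update z i 0) +
    w * (det_scaled_rows (update z i 1) - det_scaled_rows (update z i 0)).
Proof.
rewrite [LHS](@determinant_multilinear _ _ _
  (1%:M - \matrix_(a, b) (update z i 0 a * N a b))
  (1%:M - \matrix_(a, b) (update z i 1 a * N a b)) i (1 - w) w).
- by rewrite -!/(det_scaled_rows _); ring.
- by apply/rowP => b; rewrite !mxE /update eqxx; ring.
- by apply/matrixP => a b; rewrite !mxE /update [_ == i]eq_sym (negPf (neq_lift i a)).
- by apply/matrixP => a b; rewrite !mxE /update [_ == i]eq_sym (negPf (neq_lift i a)).
Qed.

Lemma ccontinuous_det_scaled_rows (T : topologicalType) (z : T -> 'I_n -> R[i]) :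
  (forall i, ccontinuous (fun t => z t i)) ->
  ccontinuous (fun t => det_scaled_rows (z t)).
Proof.
move=> cz; apply: ccontinuous_det => i j.
under eq_fun do rewrite !mxE.
apply: ccontinuousD; first exact: ccontinuous_cst.
apply: ccontinuousN; apply: ccontinuousM; first exact: cz.
exact: ccontinuous_cst.
Qed.

Lemma det_scaled_rows_eq0P z :
  reflect (exists2 c : 'cV_n, c != 0 & forall i, z i * (N *m c) i 0 = c i 0)
          (det_scaled_rows z == 0).
Proof.
have mulE (c : 'cV_n) i :
    ((\matrix_(i, j) (z i * N i j)) *m c) i 0 = z i * (N *m c) i 0.
  by rewrite !mxE mulr_sumr; apply: eq_bigr => j _; rewrite mxE mulrA.
apply: (iffP (det1B_eq0P _)) => -[c c0 zc]; exists c => //.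
  by move=> i; rewrite -mulE zc.
by apply/colP => i; rewrite mulE.
Qed.

End scaled_rows.

(** * Block vectors and block-diagonal matrices *)

Section blocks.
Variables (R : realType) (n : nat).

Lemma submxcol_mulmx (p_ q_ : 'I_n -> nat)
    (A : 'M[R[i]]_(\sum_i p_ i, \sum_i q_ i)) (x : 'cV_(\sum_i q_ i)) i :
  submxcol (A *m x) i = \sum_j submxblock A i j *m submxcol x j.
Proof. by rewrite -{1}(submxblockK A) -{1}(submxcolK x) mul_mxblock_mxrow mxcolK. Qed.

Lemma sqr_vnorm_blocks (p_ : 'I_n -> nat) (x : 'cV[R[i]]_(\sum_i p_ i)) :
  vnorm x ^+ 2 = \sum_i vnorm (submxcol x i) ^+ 2.
Proof.
under [RHS]eq_bigr do rewrite sqr_vnorm.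
rewrite sqr_vnorm [RHS]sig_big_dep/= [RHS](reindex _ tagnat.sig_bij_on)/=.
by apply: eq_bigr => s _; rewrite !mxE tagnat.sig2K.
Qed.

Lemma vnorm_submxcol_le (p_ : 'I_n -> nat) (x : 'cV[R[i]]_(\sum_i p_ i)) i :
  vnorm (submxcol x i) <= vnorm x.
Proof.
rewrite -(@ler_pXn2r _ 2)// ?nnegrE ?vnorm_ge0// sqr_vnorm_blocks (bigD1 i)//=.
by rewrite lerDl sumr_ge0// => j _; exact: sqr_ge0.
Qed.

Variables ps ks : 'I_n -> nat.
Implicit Types (D P : 'M[R[i]]_(\sum_(i < n) ps i, \sum_(i < n) ks i)).
Implicit Types x : 'cV[R[i]]_(\sum_(i < n) ks i).

Lemma submxcol_blockdiag D x i : blockdiag D ->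
  submxcol (D *m x) i = submxblock D i i *m submxcol x i.
Proof.
move=> Ddiag; rewrite submxcol_mulmx (bigD1 i)//= big1 ?addr0// => j ji.
by rewrite Ddiag ?mul0mx// eq_sym.
Qed.

(** Test D on the vector [y] that keeps block i of x and is zero elsewhere. *)
Lemma vnorm_submxcol_blockdiag D x i : blockdiag D ->
  vnorm (submxcol (D *m x) i) <= specnorm D * vnorm (submxcol x i).
Proof.
move=> Ddiag; pose y := \col_s (x s 0 *+ (tagnat.sig1 s == i)).
have yE j : submxcol y j = submxcol x j *+ (j == i).
  by apply/colP => a; rewrite !mxE tagnat.Rank1K; case: (j == i); rewrite !mxE.
have <- : submxcol (D *m y) i = submxcol (D *m x) i.
  by rewrite !submxcol_blockdiag// yE eqxx.
have <- : vnorm y = vnorm (submxcol x i).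
  apply/eqP; rewrite -(@eqrXn2 _ 2)// ?vnorm_ge0// sqr_vnorm_blocks.
  rewrite (bigD1 i)//= yE eqxx big1 ?addr0// => j /negPf ji.
  by rewrite yE ji mulr0n; apply/eqP; rewrite sqrf_eq0 vnorm_eq0.
exact: le_trans (vnorm_submxcol_le _ _) (vnorm_mulmx_le _ _).
Qed.

Lemma inPP_specnorm_le1 P : inPP P -> specnorm P <= 1.
Proof.
move=> [Pdiag Piso]; apply: specnorm_le => // x; rewrite mul1r.
rewrite -(@ler_pXn2r _ 2)// ?nnegrE ?vnorm_ge0// !sqr_vnorm_blocks.
apply: ler_sum => i _; rewrite ler_pXn2r// ?nnegrE ?vnorm_ge0//.
by rewrite submxcol_blockdiag// partial_isometry_le.
Qed.

End blocks.

(** * Unit vectors along given vectors *)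

Section direction.
Variables (R : realType) (m : nat).

(** The zero vector is sent to the first basis vector, so that the result is a unit vector in every
    nonzero dimension. *)
Definition direction (y : 'cV[R[i]]_m) : 'cV[R[i]]_m :=
  if y == 0 then \col_i (i == 0%N :> nat)%:R
  else real_complex R (vnorm y)^-1 *: y.

Lemma vnorm_direction y : (0 < m)%N -> vnorm (direction y) = 1.
Proof.
move=> m0; rewrite /direction; case: eqVneq => [_|y0].
  apply/eqP; rewrite -(@eqrXn2 _ 2)// ?vnorm_ge0// expr1n sqr_vnorm.
  rewrite (bigD1 (Ordinal m0))//= mxE eqxx big1.
    by rewrite addr0 /cabs Normc.normc1 expr1n.
  move=> i i0; rewrite mxE (_ : _ == _ = false); first by rewrite cabs0 expr0n.
  by apply: contra_neqF i0 => /eqP i0; apply: val_inj.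
rewrite vnormZ cabs_real ?invr_ge0 ?vnorm_ge0// mulVf// vnorm_eq0//.
Qed.

Lemma scale_direction y : real_complex R (vnorm y) *: direction y = y.
Proof.
rewrite /direction; case: eqVneq => [->|y0].
  by rewrite (eqP (_ : vnorm 0 == 0)) ?scale0r ?vnorm_eq0.
by rewrite scalerA -rmorphM mulfV ?vnorm_eq0// rmorph1 scale1r.
Qed.

End direction.

(** * Feasible matrices against eigenvalues of P M *)

Section mu.
Variables (R : realType) (n : nat) (ps ks : 'I_n -> nat).
Hypothesis (hps : forall i, (0 < ps i)%N) (hks : forall i, (0 < ks i)%N).
Variable M : 'M[R[i]]_(\sum_(i < n) ks i, \sum_(i < n) ps i).
Implicit Types D P : 'M[R[i]]_(\sum_(i < n) ps i, \sum_(i < n) ks i).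

(** A nonzero x with D M x = x forces 1 <= c |D| for any norm bound c of M. This keeps the infimum
    in [muS] away from 0. *)
Lemma feasible_specnorm_lower_bound :
  exists2 c : R, 0 < c & forall D, \det (1%:M - D *m M) = 0 -> c <= specnorm D.
Proof.
have [c c0 cM] := mulmx_bounded M.
exists c^-1 => [|D /eqP/det1B_eq0P[x x0 DMx]]; first by rewrite invr_gt0.
have nx0 : 0 < vnorm x by rewrite lt0r vnorm_eq0 x0 vnorm_ge0.
rewrite -div1r ler_pdivrMr// -(ler_pM2r nx0) mul1r -{1}DMx -mulmxA.
rewrite (le_trans (vnorm_mulmx_le _ _))// -mulrA.
by rewrite ler_wpM2l ?specnorm_ge0.
Qed.

Lemma eigenvalue_feasible P lam : inPP P -> lam != 0 -> eigenvalue (P *m M) lam ->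
  [/\ blockdiag (lam^-1 *: P), \det (1%:M - (lam^-1 *: P) *m M) = 0 &
      specnorm (lam^-1 *: P) <= (cabs lam)^-1].
Proof.
move=> PPP lam0 /eigenvalue_colP[x x0 PMx]; split.
- move=> i j /(PPP.1 i j) Pij; apply/matrixP => a b.
  by move/matrixP/(_ a b): Pij; rewrite !mxE => ->; rewrite mulr0.
- apply/eqP/det1B_eq0P; exists x => //.
  by rewrite -!scalemxAl PMx scalerA mulVf// scale1r.
- rewrite (le_trans (specnormZ_le _ _))// cabsV ler_piMr ?invr_ge0 ?cabs_ge0//.
  exact: inPP_specnorm_le1.
Qed.

Lemma feasible_partial_isometry D : blockdiag D -> \det (1%:M - D *m M) = 0 ->
  exists P lam, [/\ inPP P, eigenvalue (P *m M) lam & (specnorm D)^-1 <= cabs lam].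
Proof.
move=> Ddiag /eqP/det1B_eq0P[x x0 DMx].
pose q := M *m x.
pose u i := direction (submxcol x i); pose v i := direction (submxcol q i).
(* Positive block sizes provide a unit vector in each block. *)
have u1 i : vnorm (u i) = 1 by exact: vnorm_direction.
have v1 i : vnorm (v i) = 1 by exact: vnorm_direction.
pose N := \matrix_(i, j) (adjmx (v i) *m submxblock M i j *m u j) 0 0.
(* Passes between coefficients c and vectors with blocks c_j u_j; it serves both to see that [z0] is
   a zero and to build the eigenvector. *)
have NE (c : 'cV_n) i : (N *m c) i 0 =
    (adjmx (v i) *m submxcol (M *m \mxcol_j (c j 0 *: u j)) i) 0 0.
  rewrite submxcol_mulmx mulmx_sumr summxE mxE; apply: eq_bigr => j _.
  by rewrite mxcolK -!scalemxAr mulmxA !mxE mulrC.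
(* If block i of [q] is zero, the quotient is 0 by convention; block i of x then vanishes too, so
   z0_i |q_i| = |x_i| still holds. *)
pose z0 i := real_complex R (vnorm (submxcol x i) / vnorm (submxcol q i)).
have Fz0 : det_scaled_rows N z0 = 0.
  apply/eqP/det_scaled_rows_eq0P.
  exists (\col_i real_complex R (vnorm (submxcol x i))).
    apply: contra_neq x0 => c0; rewrite -(submxcolK x); apply/matrixP => i j.
    have xk0 k : submxcol x k = 0.
      rewrite -[LHS]scale_direction.
      by move/colP/(_ k): c0; rewrite !mxE => ->; rewrite scale0r.
    by rewrite mxE xk0 !mxE.
  move=> i; rewrite NE.
  have -> : \mxcol_j ((\col_k real_complex R (vnorm (submxcol x k))) j 0 *: u j) = x.
    rewrite -[RHS]submxcolK; apply: eq_mxcol => j.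
    by rewrite mxE scale_direction.
  rewrite -/q -{1}[submxcol q i]scale_direction -scalemxAr mxE -cinnerE.
  rewrite cinner_self v1 expr1n mulr1 mxE -rmorphM.
  have [q0|q0] := eqVneq (vnorm (submxcol q i)) 0; last by rewrite mulfVK.
  have := vnorm_submxcol_blockdiag q i Ddiag; rewrite mulmxA DMx q0 !mulr0.
  by move=> xi; congr (real_complex R _); apply/eqP; rewrite eq_le xi vnorm_ge0.
have z0r i : cabs (z0 i) <= specnorm D.
  rewrite cabs_real ?divr_ge0 ?vnorm_ge0//.
  have [->|q0] := eqVneq (vnorm (submxcol q i)) 0.
    by rewrite invr0 mulr0 specnorm_ge0.
  rewrite ler_pdivrMr ?lt0r ?q0 ?vnorm_ge0//.
  by have := vnorm_submxcol_blockdiag q i Ddiag; rewrite mulmxA DMx.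
have [s [z [s0 sr /eqP/det_scaled_rows_eq0P[c c0 zc] zs]]] :=
  torus_zero (det_scaled_rows_affine N) (@ccontinuous_det_scaled_rows _ _ N)
    (det_scaled_rows0 N) (specnorm_ge0 D) Fz0 z0r.
pose sV := real_complex R s^-1.
have sV1 : cabs sV = s^-1 by rewrite cabs_real// invr_ge0 ltW.
(* The factor z_i / s has modulus 1, so [u' i] is again a unit vector and each diagonal block of [P]
   is a rank-one partial isometry. *)
pose u' i := (sV * z i) *: u i.
pose P := \mxblock_(i, j) ((i == j)%:R *: (u' i *m adjmx (v j))).
exists P, sV; split.
- split=> [i j ij|i]; rewrite mxblockK.
    by rewrite (negPf ij) scale0r.
  rewrite eqxx scale1r; apply: partial_isometry_rank1 => //.
  by rewrite vnormZ u1 cabsM sV1 zs mulVf ?mulr1// gt_eqF.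
(* Its coefficients c form the fixed vector of diag(z) N. *)
- apply/eigenvalue_colP; exists (\mxcol_j (c j 0 *: u j)).
    apply: contra_neq c0 => x'0; apply/colP => i.
    have := congr1 (fun y => vnorm (submxcol y i)) x'0.
    rewrite mxcolK vnormZ u1 mulr1 submxcol0 (eqP (_ : vnorm 0 == 0)) ?vnorm_eq0//.
    by move=> /eqP; rewrite cabs_eq0 => /eqP ->; rewrite mxE.
  rewrite -(submxcolK (_ *m _ *m _)) -[RHS]submxcolK; apply: eq_mxcol => i.
  rewrite -mulmxA submxcol_blockdiag; last first.
    by move=> k l kl; rewrite mxblockK (negPf kl) scale0r.
  rewrite mxblockK eqxx scale1r -mulmxA [adjmx _ *m _]mx11_scalar -NE.
  have -> : submxcol (sV *: \mxcol_j (c j 0 *: u j)) i = sV *: (c i 0 *: u i).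
    by rewrite -[in RHS](mxcolK (fun j => c j 0 *: u j)); apply/matrixP => k l; rewrite !mxE.
  by rewrite mul_mx_scalar !scalerA -zc; congr (_ *: _); ring.
- by rewrite sV1 lef_pV2 ?posrE// (lt_le_trans s0).
Qed.

End mu.

(** * Comparison of the infimum over [D] with the supremum over [P] *)

Unset Implicit Arguments.

Theorem theorem3p1 (R : realType) (n : nat) (ps ks : 'I_n -> nat)
  (hps : forall i, (0 < ps i)%N) (hks : forall i, (0 < ks i)%N)
  (M : 'M[R[i]]_(\sum_(i < n) ks i, \sum_(i < n) ps i)) :
  muS M = sup [set specrad (P *m M) | P in
                [set P : 'M[R[i]]_(\sum_(i < n) ps i, \sum_(i < n) ks i) | inPP P]].
Proof.
(* The eigenvalue 0 yields no feasible matrix, but meets every nonnegative bound. *)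
have eig_le P m lam : 0 <= m -> (lam != 0 -> eigenvalue (P *m M) lam -> cabs lam <= m) ->
    eigenvalue (P *m M) lam -> cabs lam <= m.
  by have [->|lam0 _ /(_ isT)] := eqVneq lam 0; rewrite ?cabs0.
have specrad_ge0 P : 0 <= specrad (P *m M).
  by apply: sup_nonneg => _ [lam _ <-]; exact: cabs_ge0.
rewrite /muS; case: asboolP => [[D0 [D0diag D0det]]|infeasible]; last first.
  (* Without a feasible D, no P M has a nonzero eigenvalue, so the supremum is 0 as well. *)
  apply/esym/le_anti/andP; split; last by apply: sup_nonneg => _ [P _ <-].
  apply: sup_le_nonneg => // _ [P PPP <-].
  apply: sup_le_nonneg => // _ [lam /= + <-]; apply: eig_le => // lam0 eigP.
  have [Pdiag Pdet _] := eigenvalue_feasible PPP lam0 eigP.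
  by exfalso; apply: infeasible; exists (lam^-1 *: P).
set E := [set specnorm D | D in _].
have E0 : E !=set0 by exists (specnorm D0), D0.
have [c c0 cD] := feasible_specnorm_lower_bound M.
have clb : lbound E c by move=> _ [D [_ Ddet] <-]; exact: cD.
have infE0 : 0 < inf E by rewrite (lt_le_trans c0)// lb_le_inf.
have eig_ub P lam : inPP P -> eigenvalue (P *m M) lam -> cabs lam <= (inf E)^-1.
  move=> PPP; apply: eig_le => [|lam0 eigP]; first by rewrite invr_ge0 ltW.
  have [Pdiag Pdet Pnorm] := eigenvalue_feasible PPP lam0 eigP.
  have lamgt0 : 0 < cabs lam by rewrite lt0r cabs_eq0 lam0 cabs_ge0.
  rewrite -[leLHS]invrK lef_pV2 ?posrE ?invr_gt0//.
  apply: le_trans Pnorm; apply: ge_inf; first by exists c.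
  by exists (lam^-1 *: P).
have specrad_ub P : inPP P -> specrad (P *m M) <= (inf E)^-1.
  move=> PPP; apply: sup_le_nonneg => [|_ [lam eigP <-]]; last exact: eig_ub eigP.
  by rewrite invr_ge0 ltW.
set S := sup _.
have S_lb D : blockdiag D -> \det (1%:M - D *m M) = 0 -> (specnorm D)^-1 <= S.
  move=> Ddiag Ddet.
  have [P [lam [PPP eigP /le_trans]]] := feasible_partial_isometry hps hks Ddiag Ddet.
  (* Both suprema are over sets bounded by [(inf E)^-1], so their members lie below them. *)
  apply; apply: (@le_trans _ _ (specrad (P *m M))).
    apply: ub_le_sup; last by exists lam.
    by exists (inf E)^-1 => _ [l eigl <-]; exact: eig_ub eigl.
  apply: ub_le_sup; last by exists P.
  by exists (inf E)^-1 => _ [Q QPP <-]; exact: specrad_ub.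
have S0 : 0 < S.
  apply: lt_le_trans (S_lb _ D0diag D0det).
  by rewrite invr_gt0 (lt_le_trans c0)// cD.
apply/le_anti/andP; split; last first.
  apply: sup_le_nonneg => [|_ [P PPP <-]]; last exact: specrad_ub.
  by rewrite invr_ge0 ltW.
(* As both sides are positive, it remains that [S^-1] is a lower bound of [E], which is [S_lb]
   inverted. *)
rewrite -[leRHS]invrK lef_pV2 ?posrE ?invr_gt0//.
apply: lb_le_inf => // _ [D [Ddiag Ddet] <-].
rewrite -[leRHS]invrK lef_pV2 ?posrE ?invr_gt0// ?S_lb//.
by rewrite (lt_le_trans c0)// cD.
Qed.
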